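(* Let $\mathrm{Aut}_{\mathbb{Q}}(\mathbb{S}^1)$ be the subgroup of $\mathrm{Aut}(\mathbb{S}^1)$ consisting of those homeomorphisms $g$ with $g(\mathbb{Q}^1)=\mathbb{Q}^1$. For $g\in \mathrm{Aut}_{\mathbb{Q}}(\mathbb{S}^1)$, let $\pi(g)$ be the automorphism of $\mathcal{C}_{\mathbb{Q}}$ that maps the chord with endpoints $x,y$ to the chord with endpoints $g(x),g(y)$, for all distinct $x,y\in\mathbb{Q}^1$. Then $\pi$ is a group isomorphism from $\mathrm{Aut}_{\mathbb{Q}}(\mathbb{S}^1)$ onto $\mathrm{Aut}(\mathcal{C}_{\mathbb{Q}})$.
   Context: $\mathbb{S}^1$ is the unit circle in $\mathbb{R}^2$, identified with the space obtained from $[0,1]$ by identifying $0$ with $1$; $\mathbb{Q}^1\subset\mathbb{S}^1$ is the set of rational points under this identification. $\mathrm{Aut}(\mathbb{S}^1)$ is the group of all homeomorphisms of $\mathbb{S}^1$ onto itself (orientation-preserving or not). A chord of $\mathbb{S}^1$ is a (closed) straight line segment joining two distinct points of $\mathbb{S}^1$. The rational circle graph $\mathcal{C}_{\mathbb{Q}}$ is the graph whose vertices are the chords with both endpoints in $\mathbb{Q}^1$, in which two distinct chords are adjacent if and only if they intersect (either at a point of $\mathbb{S}^1$ or at a point inside it). For a graph $G$, $\mathrm{Aut}(G)$ denotes its automorphism group. *)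

(* Defs.v *)
From HB Require Import structures.
From mathcomp Require Import all_boot all_order all_algebra.
From mathcomp Require Import all_classical all_reals all_analysis.
Set Implicit Arguments.
Unset Strict Implicit.
Unset Printing Implicit Defensive.
Import Order.TTheory GRing.Theory Num.Theory.
Import numFieldNormedType.Exports.
Local Open Scope classical_set_scope.
Local Open Scope ring_scope.

Record sym (T : choiceType) := Sym {
  sym_fun :> T -> T;
  _ : `[< bijective sym_fun >] }.

HB.instance Definition _ (T : choiceType) := [isSub for @sym_fun T].
HB.instance Definition _ (T : choiceType) := [Choice of sym T by <:].

Section SymGroup.
Variable T : choiceType.
Implicit Types s t : sym T.

Lemma sym_bij s : bijective s. Proof. exact/asboolP/(valP s). Qed.

Definition sym_one : sym T := Sym (asboolT (@Bijective T T id id (fun=> erefl) (fun=> erefl))).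

(* The product is composition: [(s * t) x = s (t x)]. *)
Definition sym_mul s t : sym T :=
  Sym (asboolT (bij_comp (sym_bij s) (sym_bij t))).

Lemma sym_inv_ex s : exists g : T -> T, cancel s g /\ cancel g s.
Proof. by have [g sK gK] := sym_bij s; exists g. Qed.

Definition sym_inv_fun s : T -> T := sval (cid (sym_inv_ex s)).

Lemma sym_funK s : cancel s (sym_inv_fun s).
Proof. exact: (svalP (cid (sym_inv_ex s))).1. Qed.

Lemma sym_inv_funK s : cancel (sym_inv_fun s) s.
Proof. exact: (svalP (cid (sym_inv_ex s))).2. Qed.

Definition sym_inv s : sym T :=
  Sym (asboolT (Bijective (sym_inv_funK s) (sym_funK s))).

Lemma sym_mulA : associative sym_mul.
Proof. by move=> s t u; apply: val_inj. Qed.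

Lemma sym_mul1 : left_id sym_one sym_mul.
Proof. by move=> s; apply: val_inj. Qed.

Lemma sym_1mul : right_id sym_one sym_mul.
Proof. by move=> s; apply: val_inj. Qed.

Lemma sym_mulV : left_inverse sym_one sym_inv sym_mul.
Proof. by move=> s; apply/val_inj/funext => x; exact: sym_funK. Qed.

Lemma sym_Vmul : right_inverse sym_one sym_inv sym_mul.
Proof. by move=> s; apply/val_inj/funext => x; exact: sym_inv_funK. Qed.

HB.instance Definition _ :=
  isGroup.Build (sym T) sym_mulA sym_mul1 sym_1mul sym_mulV sym_Vmul.

Lemma sym1E x : (1%g : sym T) x = x. Proof. by []. Qed.
Lemma symME s t x : (s * t)%g x = s (t x). Proof. by []. Qed.
Lemma symVK s x : s^-1%g (s x) = x. Proof. exact: sym_funK. Qed.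
Lemma symKV s x : s (s^-1%g x) = x. Proof. exact: sym_inv_funK. Qed.

End SymGroup.

Section Homeomorphisms.
Variable T : topologicalType.

Definition is_homeo : pred (sym T) :=
  fun s => `[< continuous s /\ continuous (s^-1%g : sym T) >].

Lemma is_homeo_group_closed : group_closed is_homeo.
Proof.
split=> [|s t /asboolP[cs cVs] /asboolP[ct cVt]]; apply/asboolP.
  by rewrite invg1; split=> x; exact: cvg_id.
rewrite invgF; split=> x.
  by apply: (@continuous_comp _ _ _ (t^-1%g : sym T) s); [exact: cVt|exact: cs].
by apply: (@continuous_comp _ _ _ (s^-1%g : sym T) t); [exact: cVs|exact: ct].
Qed.

Record homeo := Homeo { homeo_sym :> sym T; _ : is_homeo homeo_sym }.

HB.instance Definition _ := [isSub for homeo_sym].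
HB.instance Definition _ := [Choice of homeo by <:].
HB.instance Definition _ :=
  SubChoice_isSubGroup.Build (sym T) is_homeo homeo is_homeo_group_closed.

End Homeomorphisms.

Section HomeoPreserving.
Variables (T : topologicalType) (A : set T).

Definition preserves : pred (homeo T) := fun g => `[< g @` A = A >].

Lemma preserves_group_closed : group_closed preserves.
Proof.
split=> [|s t /asboolP sA /asboolP tA]; apply/asboolP; first exact: image_id.
have tVA : (t^-1)%g @` A = A.
  rewrite -[in LHS]tA image_comp -[RHS]image_id.
  by congr (_ @` A); apply/funext => x; exact: symVK.
by rewrite -[RHS]sA -[in RHS]tVA image_comp.
Qed.

Record homeo_on := HomeoOn {
  homeo_on_homeo :> homeo T;
  _ : preserves homeo_on_homeo }.

HB.instance Definition _ := [isSub for homeo_on_homeo].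
HB.instance Definition _ := [Choice of homeo_on by <:].
HB.instance Definition _ :=
  SubChoice_isSubGroup.Build (homeo T) preserves homeo_on preserves_group_closed.

End HomeoPreserving.

Record graph := Graph {
  vertex : choiceType;
  adj : vertex -> vertex -> Prop;
  adj_sym : forall u v, adj u v -> adj v u;
  adj_irrefl : forall u, ~ adj u u }.

Section GraphAut.
Variable G : graph.

Definition is_graph_aut : pred (sym (vertex G)) :=
  fun s => `[< forall u v, adj (s u) (s v) <-> adj u v >].

Lemma is_graph_aut_group_closed : group_closed is_graph_aut.
Proof.
split=> [|s t /asboolP sP /asboolP tP]; apply/asboolP => // u v.
have := tP ((t^-1)%g u) ((t^-1)%g v); rewrite !symKV => tV.
by rewrite !symME sP; split=> /tV.
Qed.

Record graph_aut := GraphAut {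
  graph_aut_sym :> sym (vertex G);
  _ : is_graph_aut graph_aut_sym }.

HB.instance Definition _ := [isSub for graph_aut_sym].
HB.instance Definition _ := [Choice of graph_aut by <:].
HB.instance Definition _ := SubChoice_isSubGroup.Build
  (sym (vertex G)) is_graph_aut graph_aut is_graph_aut_group_closed.

End GraphAut.

Section RationalCircleGraph.
Variable R : realType.

Definition unit_circle : set (R * R) := [set p | p.1 ^+ 2 + p.2 ^+ 2 = 1].

(* [set_type] carries the subspace topology. *)
Definition S1 : topologicalType := set_type unit_circle.

(* The identification of [0, 1] / (0 ~ 1) with the unit circle. *)
Definition circle_param (t : R) : R * R :=
  (cos (2 * pi * t), sin (2 * pi * t)).

Definition Q1 : set S1 :=
  [set x | exists2 q : rat, 0 <= q <= 1 & set_val x = circle_param (ratr q)].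

Definition segment (p q : R * R) : set (R * R) :=
  [set (line_path p.1 q.1 t, line_path p.2 q.2 t) | t in `[0, 1]].

Definition chord (x y : S1) : set (R * R) := segment (set_val x) (set_val y).

Definition rational_chords : set (set (R * R)) :=
  [set C | exists x y : S1, [/\ Q1 x, Q1 y, x <> y & C = chord x y]].

Definition chord_adj (C D : set_type rational_chords) : Prop :=
  C <> D /\ set_val C `&` set_val D !=set0.

Lemma chord_adj_sym C D : chord_adj C D -> chord_adj D C.
Proof. by move=> [/nesym CD]; rewrite setIC. Qed.

Lemma chord_adj_irrefl C : ~ chord_adj C C.
Proof. by case. Qed.

Definition rational_circle_graph : graph :=
  Graph chord_adj_sym chord_adj_irrefl.

End RationalCircleGraph.

(* Main.v *)
(* A homeomorphism [h] of the circle preserves the relation "the chords [xy]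
   and [zw] meet": if they do not, [z] and [w] are joined by an arc avoiding [x]
   and [y], and along it the orientation of the triangle [h x, h y, h .] never
   vanishes.  So [g |-> pi g] is well defined, and it is injective because the
   rational points are dense.

   For surjectivity, the graph determines which chords share an endpoint.  Say
   that [E] is covered by [C] and [D] if every chord meeting [E] meets [C] or
   [D]; then [E] has its endpoints among those of [C] and [D].  Two chords
   [ab], [ac] cover only one further chord, [bc], whereas two crossing chords
   cover the four sides of the quadrilateral they span.  Covering also tells
   triangles from stars, so a graph automorphism maps the chords through a
   rational point to the chords through another one, and is therefore induced
   by a bijection of the rational points that preserves crossing.  Read off
   from the image of [0], such a bijection is an increasing or decreasing
   bijection of the rationals of [0, 1[, which extends by suprema to an
   increasing homeomorphism of the line and hence to the circle. *)
Require Import Defs.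
From HB Require Import structures.
From mathcomp Require Import all_boot all_order all_algebra.
From mathcomp Require Import all_classical all_reals all_analysis.
From mathcomp Require Import ring lra.
Set Implicit Arguments.
Unset Strict Implicit.
Unset Printing Implicit Defensive.
Import Order.TTheory GRing.Theory Num.Theory.
Import numFieldNormedType.Exports.
Local Open Scope classical_set_scope.
Local Open Scope ring_scope.

(** * Crossing of chords in a linear order *)

Section Crossing.
Context {d : Order.disp_t} {T : orderType d}.
Local Open Scope order_scope.
Implicit Types a b c x y z w : T.

(* For [z] other than [a] and [b], this says that [z] lies strictly between
   them; the chords [xy] and [zw] of the circle cut open at one point then
   cross when exactly one of [z], [w] is between [x] and [y]. *)
Definition between a b z := (a < z) (+) (b < z).

Definition chords_meet x y z w :=
  [|| x == z, x == w, y == z, y == w | between x y z != between x y w].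

Lemma betweenC a b z : between a b z = between b a z.
Proof. by rewrite /between addbC. Qed.

Lemma chords_meetCl x y z w : chords_meet x y z w = chords_meet y x z w.
Proof.
rewrite /chords_meet !(betweenC x).
by case: (x == z); case: (x == w); case: (y == z); case: (y == w).
Qed.

Lemma chords_meetCr x y z w : chords_meet x y z w = chords_meet x y w z.
Proof.
rewrite /chords_meet [between x y w == _]eq_sym.
by case: (x == z); case: (x == w); case: (y == z); case: (y == w).
Qed.

Lemma lt_flip a b : a != b -> (b < a) = ~~ (a < b).
Proof. by case: ltgtP. Qed.

Lemma chords_meet_sym x y z w : chords_meet x y z w = chords_meet z w x y.
Proof.
rewrite /chords_meet /between ![z == _]eq_sym ![w == _]eq_sym.
case: eqVneq => //= xz; case: eqVneq => //= xw; rewrite ?orbT//.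
case: eqVneq => //= yz; case: eqVneq => //= yw.
rewrite (lt_flip xz) (lt_flip xw) (lt_flip yz) (lt_flip yw).
by case: (x < z); case: (x < w); case: (y < z); case: (y < w).
Qed.

(** When [x <= y], both [z] and [w] lie above [x] and not above [y], whereas [a] lies outside this
    interval and so compares alike with both. *)
Lemma between_sep x y z w a : x != a -> y != a ->
  between x y z -> between x y w -> ~~ between x y a -> (a < z) = (a < w).
Proof.
wlog xy : x y / x <= y => [hw xa ya zP wP aP|].
  have [|/ltW yx] := leP x y; first by move/hw; apply.
  by apply: (hw y x); rewrite // betweenC.
move=> xa ya.
have inE u : between x y u -> x < u <= y.
  rewrite /between; have [xu|ux] := ltP x u; first by rewrite addTb -leNgt.
  by rewrite addFb => /(le_lt_trans xy); rewrite ltNge ux.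
move=> /inE/andP[xz zy] /inE/andP[xw wy].
rewrite /between; case: (ltgtP y a) ya => // ya _.
  by rewrite !ltNge (le_trans zy (ltW ya)) (le_trans wy (ltW ya)).
rewrite addbF -leNgt => ax.
by rewrite (le_lt_trans ax xz) (le_lt_trans ax xw).
Qed.

Lemma chords_meetPn x y z w : ~~ chords_meet x y z w <->
  [/\ x != z, x != w, y != z, y != w & between x y z = between x y w].
Proof.
rewrite /chords_meet !negb_or negbK.
by split=> [/and5P[? ? ? ? /eqP ?]|[-> -> -> -> ->]]; rewrite ?eqxx.
Qed.

(* A chord missing [ab] and [ce] but meeting [ac] would separate [ab]
   from [ce]. *)
Lemma chords_meet_bridge a b c e x y : chords_meet a b c e ->
  ~~ chords_meet x y a b -> ~~ chords_meet x y c e -> ~~ chords_meet x y a c.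
Proof.
wlog xya : a b c e / between x y a => [hw mt|].
  have [xya|nxya] := boolP (between x y a); first exact: (hw a b c e).
  have [xyc|nxyc] := boolP (between x y c); last first.
    move=> /chords_meetPn[xa _ ya _ _] /chords_meetPn[xc _ yc _ _].
    by apply/chords_meetPn; split=> //; rewrite (negbTE nxya) (negbTE nxyc).
  by move=> ab ce; rewrite chords_meetCr; apply: (hw c e a b); rewrite // chords_meet_sym.
move=> + /chords_meetPn[xa xb ya yb E1] /chords_meetPn[xc xe yc ye E2].
have xyb : between x y b by rewrite -E1.
have [xyc|nxyc] := boolP (between x y c).
  by move=> _; apply/chords_meetPn; split=> //; rewrite xya xyc.
have nxye : ~~ between x y e by rewrite -E2.
have neq u v : between x y u -> ~~ between x y v -> u == v = false.
  by move=> xyu; case: eqVneq => // <-; rewrite xyu.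
suff -> : chords_meet a b c e = false by [].
(* The chord [xy] separates [a], [b] from [c], [e]; hence [c] compares alike with [a] and [b], so
   does [e], and [ce] cannot cross [ab]. *)
rewrite chords_meet_sym /chords_meet ![c == _]eq_sym ![e == _]eq_sym !neq//=.
by rewrite {1 2}/between (between_sep xc yc xya xyb nxyc)
  (between_sep xe ye xya xyb nxye) eqxx.
Qed.

(** Hence one side of a triangle is covered by the other two. *)
Lemma chords_meet_triangle a b c x y :
  ~~ chords_meet x y a b -> ~~ chords_meet x y a c -> ~~ chords_meet x y b c.
Proof.
move=> /chords_meetPn[xa xb ya yb E1] /chords_meetPn[_ xc _ yc E2].
by apply/chords_meetPn; split => //; rewrite -E1 -E2.
Qed.

Lemma chords_meet_shared x y z : chords_meet x y x z.
Proof. by rewrite /chords_meet eqxx. Qed.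

End Crossing.

(** * Points recovered from the intersection graph *)

Section Reconstruction.
Context {d : Order.disp_t} {T : orderType d} {V : Type}.
Variables (ch : T -> T -> V) (mt : V -> V -> Prop).
Local Open Scope order_scope.
Implicit Types (a b c x y z w : T) (C D E F : V).

Hypothesis T_unbounded : forall x, exists y, x < y.
Hypothesis T_dense : forall x y, x < y -> exists2 z, x < z & z < y.
Hypothesis chC : forall x y, ch x y = ch y x.
Hypothesis ch_surj : forall C, exists x y, x != y /\ C = ch x y.
Hypothesis ch_inj : forall x y z w, x != y -> z != w -> ch x y = ch z w ->
  (x = z /\ y = w) \/ (x = w /\ y = z).
Hypothesis mtP : forall x y z w, x != y -> z != w ->
  mt (ch x y) (ch z w) <-> chords_meet x y z w.

Definition incident x C := exists2 y, x != y & C = ch x y.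

Definition covered E C D := forall F, mt F E -> mt F C \/ mt F D.

(* Two chords [ab], [ac] cover only one further chord, namely [bc], while two
   crossing chords cover the four sides of a quadrilateral. *)
Definition touching C D := [/\ C <> D, mt C D &
  forall E E', covered E C D -> covered E' C D ->
    E <> C -> E <> D -> E' <> C -> E' <> D -> E = E'].

(** This yields chords so short that they separate no two points of [s]. *)
Lemma gt_near x (s : seq T) :
  exists2 x', x < x' & forall a, a \in s -> x < a -> x' < a.
Proof.
elim: s => [|b s [x' xx' IH]]; first by have [x' ?] := T_unbounded x; exists x'.
have [bx'|x'b] := leP b x'; last first.
  by exists x' => // a /[!inE] /predU1P[->//|]; exact: IH.
have [xb|bx] := ltP x b; last first.
  by exists x' => // a /[!inE] /predU1P[->|]; [rewrite ltNge bx|exact: IH].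
have [z xz zb] := T_dense xb; exists z => // a /[!inE] /predU1P[->//|sa xa].
exact: lt_trans (lt_le_trans zb bx') (IH _ sa xa).
Qed.

(** If [u] were none of the four ends, a chord from [u] to a point just above it would meet [ch u v]
    and miss both [ch a b] and [ch c e]. *)
Lemma covered_ends u v a b c e : u != v -> a != b -> c != e ->
  covered (ch u v) (ch a b) (ch c e) -> u \in [:: a; b; c; e].
Proof.
move=> uv ab ce cov; apply/negPn/negP => us.
have [u' uu' u'P] := gt_near u [:: a; b; c; e].
have out s : s \in [:: a; b; c; e] -> [/\ u != s, u' != s & between u u' s = false].
  move=> ss; have us' : u != s by apply: contraNneq us => ->.
  rewrite /between; case: (ltgtP u s) us' => // [us'|su] _.
    by have u's := u'P _ ss us'; rewrite u's lt_eqF.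
  by rewrite gt_eqF ?(lt_trans su)// ltNge (ltW (lt_trans su uu')).
have miss x y : x \in [:: a; b; c; e] -> y \in [:: a; b; c; e] -> ~~ chords_meet u u' x y.
  by move=> /out[? ? Ex] /out[? ? Ey]; apply/chords_meetPn; rewrite Ex Ey.
have uu'n : u != u' by rewrite lt_eqF.
have /cov : mt (ch u u') (ch u v) by apply/mtP => //; exact: chords_meet_shared.
by case=> [/(mtP uu'n ab)|/(mtP uu'n ce)]; apply/negP/miss;
  rewrite !inE eqxx ?orbT.
Qed.

Lemma touching_incident C D :
  touching C D <-> C <> D /\ exists x, incident x C /\ incident x D.
Proof.
split=> [[CD]|[CD [x [[b xb CE] [c xc DE]]]]].
  have [a [b [ab CE]]] := ch_surj C; have [c [e [ce DE]]] := ch_surj D.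
  move=> CmD uniq; split=> //.
  have inc x y : x != y -> incident x (ch x y) /\ incident y (ch x y).
    by move=> xy; split; [exists y|exists x => //; rewrite eq_sym].
  have [aC bC] := inc _ _ ab; have [cD eD] := inc _ _ ce.
  have [ac|ac] := eqVneq a c; first by exists a; rewrite CE DE; split=> //; rewrite ac.
  have [ae|ae] := eqVneq a e; first by exists a; rewrite CE DE; split=> //; rewrite ae.
  have [bc|bc] := eqVneq b c; first by exists b; rewrite CE DE; split=> //; rewrite bc.
  have [be|be] := eqVneq b e; first by exists b; rewrite CE DE; split=> //; rewrite be.
  have abce : chords_meet a b c e by apply/mtP => //; rewrite -CE -DE.
  (* By [chords_meet_bridge], a chord that meets [uc] meets [uv] or [ce]. With no shared end, [ac]
     and [bc] are thus two covered chords, against uniqueness. *)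
  have cov u v : u != v -> u != c -> chords_meet u v c e ->
      covered (ch u c) (ch u v) (ch c e).
    move=> uv uc muv F; have [x [y [xy ->]]] := ch_surj F.
    move=> /(mtP xy uc) m.
    have [/(mtP xy uv)|n1] := boolP (chords_meet x y u v); first by left.
    have [/(mtP xy ce)|n2] := boolP (chords_meet x y c e); first by right.
    by have := chords_meet_bridge muv n1 n2; rewrite m.
  have ne x y z w : x != y -> z != w -> x != z -> x != w -> ch x y <> ch z w.
    by move=> xy zw xz xw /ch_inj[]// [] /eqP; rewrite ?(negbTE xz) ?(negbTE xw).
  have [ba ca cb] : [/\ b != a, c != a & c != b].
    by rewrite ![_ == a]eq_sym [c == b]eq_sym.
  have : ch a c = ch b c.
    apply: uniq; rewrite ?CE ?DE; try exact: ne.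
    - exact: cov.
    - by rewrite (chC a); apply: cov; rewrite // chords_meetCl.
    - by rewrite chC; exact: ne.
    - by rewrite chC; exact: ne.
  by move=> E; case: (ne a c b c).
have bc : b != c by apply/eqP => bc; apply: CD; rewrite CE DE bc.
split=> //; first by rewrite CE DE; apply/mtP => //; exact: chords_meet_shared.
(* Conversely, both ends of a covered chord are among [x], [b], [c], which leaves only [bc] besides
   [C] and [D]. *)
have only E : covered E C D -> E <> C -> E <> D -> E = ch b c.
  have [u [v [uv ->]]] := ch_surj E; rewrite CE DE => cov uxb uxc.
  have := covered_ends uv xb xc cov.
  rewrite chC in cov; have := covered_ends _ xb xc cov.
  rewrite eq_sym => /(_ uv); rewrite !inE.
  move=> /or4P[] /eqP ? /or4P[] /eqP ?; subst;
    (done || exact: chC || (by rewrite eqxx in uv) || (by case: uxb)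
     || (by case: uxb; exact: chC) || (by case: uxc) || (by case: uxc; exact: chC)).
by move=> E E' cE cE' EC ED E'C E'D; rewrite (only E)// (only E').
Qed.

Lemma incident_l x y : x != y -> incident x (ch x y).
Proof. by exists y. Qed.

Lemma incident_r x y : x != y -> incident y (ch x y).
Proof. by rewrite eq_sym => yx; exists x. Qed.

Lemma incident_ends p x y : x != y -> incident p (ch x y) -> p = x \/ p = y.
Proof. by move=> xy [z pz /ch_inj[]// [? ?]]; [left|right]. Qed.

Lemma incident2 C x y : x != y -> incident x C -> incident y C -> C = ch x y.
Proof.
by move=> xy [z xz ->] /(incident_ends xz)[yx|->//]; rewrite yx eqxx in xy.
Qed.

Lemma incident_unique C D x y : C <> D -> incident x C -> incident x D ->
  incident y C -> incident y D -> x = y.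
Proof.
move=> CD xC xD yC yD; have [//|xy] := eqVneq x y.
by case: CD; rewrite (incident2 xy xC yC) (incident2 xy xD yD).
Qed.

(** If [E] avoided [x], it would join the other ends of [C] and [D]; as the third side of a triangle
    it would be covered. *)
Lemma touching_star C D E x : C <> D -> incident x C -> incident x D ->
  touching E C -> touching E D -> ~ covered E C D -> incident x E.
Proof.
move=> CD [b xb CE] [c xc DE] /touching_incident[EC [p [pE pC]]].
move=> /touching_incident[ED [q [qE qD]]] ncov; subst C D.
have [px|pb] := incident_ends xb pC; first by rewrite -px.
have [qx|qc] := incident_ends xc qD; first by rewrite -qx.
case: ncov; rewrite pb qc in pE qE *.
have bc : b != c by apply/eqP => bc; apply: CD; rewrite bc.
rewrite (incident2 bc pE qE) => F; have [u [v [uv ->]]] := ch_surj F.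
move=> /(mtP uv bc) m.
have [/(mtP uv xb)|n1] := boolP (chords_meet u v x b); first by left.
have [/(mtP uv xc)|n2] := boolP (chords_meet u v x c); first by right.
by have := chords_meet_triangle n1 n2; rewrite m.
Qed.

(** The second end of [E] is no end of [C] or [D], which [covered_ends] forbids for a covered
    chord. *)
Lemma star_not_covered C D E x : C <> D -> E <> C -> E <> D ->
  incident x C -> incident x D -> incident x E -> ~ covered E C D.
Proof.
move=> CD EC ED [b xb CE] [c xc DE] [e xe EE] cov; subst C D E.
rewrite chC in cov; have := covered_ends _ xb xc cov; rewrite eq_sym.
move=> /(_ xe); rewrite !inE ![e == x]eq_sym (negbTE xe) /=.
by move=> /orP[] /eqP ?; subst e; [case: EC|case: ED].
Qed.

Lemma another x y : exists2 z, z != x & z != y.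
Proof.
have [z zxy] := T_unbounded (Order.max x y).
by move: zxy; rewrite gt_max => /andP[xz yz]; exists z; rewrite gt_eqF.
Qed.

Lemma incident_pair x : exists C D, [/\ C <> D, incident x C & incident x D].
Proof.
have [y yx _] := another x x; have [z zx zy] := another x y.
exists (ch x y), (ch x z); split; try by apply: incident_l; rewrite eq_sym.
by rewrite eq_sym in yx => /ch_inj[]; rewrite 1?[x == z]eq_sym// => -[] /eqP;
  rewrite ?[x == z]eq_sym ?(negbTE zx)// => _ /eqP; rewrite eq_sym (negbTE zy).
Qed.

Lemma covered_morph (f g : V -> V) C D E : cancel g f ->
  (forall C' D', mt (f C') (f D') <-> mt C' D') ->
  covered E C D -> covered (f E) (f C) (f D).
Proof.
move=> gK fmt cov F; rewrite -(gK F) => /fmt /cov.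
by move=> [] /fmt; [left|right].
Qed.

Lemma mt_morph_inv (f g : V -> V) : cancel g f ->
  (forall C D, mt (f C) (f D) <-> mt C D) ->
  forall C D, mt (g C) (g D) <-> mt C D.
Proof. by move=> gK fmt C D; rewrite -fmt !gK. Qed.

Lemma touching_morph (f g : V -> V) C D : cancel f g -> cancel g f ->
  (forall C' D', mt (f C') (f D') <-> mt C' D') ->
  touching C D -> touching (f C) (f D).
Proof.
move=> fK gK fmt; have gmt := mt_morph_inv gK fmt.
move=> [CD mCD uniq]; split; [by move=> /(can_inj fK)|exact/fmt|].
move=> E E' cE cE' EC ED E'C E'D.
rewrite -(gK E) -(gK E'); congr f; apply: uniq.
- by rewrite -(fK C) -(fK D); exact: (covered_morph fK gmt).
- by rewrite -(fK C) -(fK D); exact: (covered_morph fK gmt).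
- by move=> E0; apply: EC; rewrite -E0 gK.
- by move=> E0; apply: ED; rewrite -E0 gK.
- by move=> E0; apply: E'C; rewrite -E0 gK.
- by move=> E0; apply: E'D; rewrite -E0 gK.
Qed.

(** The point [x'] is the common end of the images of two fixed chords [C], [D] at [x]. Any other
    chord at [x] touches both and is not covered by them; [f] preserves this, so [touching_star]
    applies to its image. *)
Lemma point_image (f g : V -> V) : cancel f g -> cancel g f ->
  (forall C D, mt (f C) (f D) <-> mt C D) ->
  forall x, exists x', forall C, incident x C -> incident x' (f C).
Proof.
move=> fK gK fmt x; have [C [D [CD xC xD]]] := incident_pair x.
have fI := can_inj fK.
have tch u v : u <> v -> incident x u -> incident x v -> touching (f u) (f v).
  move=> uv xu xv; apply: (touching_morph fK gK fmt).
  by apply/touching_incident; split=> //; exists x.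
have /touching_incident[fCD [x' [x'C x'D]]] := tch _ _ CD xC xD.
exists x' => E xE.
have [->//|EC] := pselect (E = C); have [->//|ED] := pselect (E = D).
apply: (touching_star fCD x'C x'D); [exact: tch|exact: tch|].
move=> /(covered_morph fK (mt_morph_inv gK fmt)); rewrite !fK.
exact: star_not_covered xC xD xE.
Qed.

(** Both [f] and [g] induce point maps. They are mutually inverse because a point is determined by
    two distinct chords through it. *)
Lemma chord_map_from_points (f g : V -> V) : cancel f g -> cancel g f ->
  (forall C D, mt (f C) (f D) <-> mt C D) ->
  exists h h' : T -> T, [/\ cancel h h', cancel h' h &
    forall x y, x != y -> f (ch x y) = ch (h x) (h y)].
Proof.
move=> fK gK fmt; have gmt := mt_morph_inv gK fmt.
have /choice[h hP] := point_image fK gK fmt.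
have /choice[h' h'P] := point_image gK fK gmt.
have hK : cancel h h'.
  move=> x; have [C [D [CD xC xD]]] := incident_pair x.
  apply: (incident_unique CD) => //; [rewrite -(fK C)|rewrite -(fK D)];
  by apply/h'P/hP.
have h'K : cancel h' h.
  move=> x; have [C [D [CD xC xD]]] := incident_pair x.
  apply: (incident_unique CD) => //; [rewrite -(gK C)|rewrite -(gK D)];
  by apply/hP/h'P.
exists h, h'; split=> // x y xy; apply: incident2.
- by rewrite (can_eq hK).
- exact/hP/incident_l.
- exact/hP/incident_r.
Qed.

End Reconstruction.

(** * From crossing to monotonicity *)

Section CyclicOrder.
Context {d : Order.disp_t} {T : orderType d}.
Local Open Scope order_scope.
Variables (z0 : T) (u : T -> T).
Hypothesis z0_min : forall x, z0 <= x.
Hypothesis T_unbounded : forall x : T, exists y, x < y.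
Hypothesis u_inj : injective u.
Hypothesis u_z0 : u z0 = z0.
Hypothesis u_meets : forall x y z w, x != y -> z != w ->
  chords_meet (u x) (u y) (u z) (u w) = chords_meet x y z w.

(* The chord [z0 b] crosses [ac] exactly when [b] lies between [a] and [c]. *)
Lemma chords_meet_preserving_betweenness a b c : z0 < a -> a < b -> b < c ->
  (u a < u b) = (u b < u c).
Proof.
move=> z0_lt_a ab bc.
have gt_z0 x : z0 < x -> z0 < u x.
  by move=> ox; rewrite lt_neqAle z0_min andbT -{1}u_z0 (inj_eq u_inj) lt_eqF.
have ob := lt_trans z0_lt_a ab; have oc := lt_trans ob bc.
have : chords_meet (u z0) (u b) (u a) (u c).
  rewrite u_meets ?lt_eqF ?(lt_trans ab bc)//.
  by rewrite /chords_meet /between z0_lt_a bc oc [b < a]ltNge (ltW ab) !orbT.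
rewrite u_z0 /chords_meet ![z0 == _]lt_eqF ?gt_z0//= !(inj_eq u_inj).
rewrite (gt_eqF ab) (lt_eqF bc) /= /between !gt_z0//=.
rewrite [u a < _]lt_flip ?(inj_eq u_inj) ?(gt_eqF ab)//.
by case: (u b < u a); case: (u b < u c).
Qed.

(** Betweenness gives [u a < u b] the same truth value for all pairs [a < b] above [z0]. The fixed
    minimum [z0] fits only the increasing case, hence its exclusion from the other. *)
Lemma chords_meet_preserving_monotone : 
  (forall x y, x < y -> u x < u y) \/ (forall x y, z0 < x -> x < y -> u y < u x).
Proof.
have key a b c e : z0 < a -> a < b -> z0 < c -> c < e -> (u a < u b) = (u c < u e).
  (* A point [m] beyond both pairs lets each be compared with its continuation up to [m]. *)
  have [m bm] := T_unbounded (Order.max b e).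
  move: bm; rewrite gt_max => /andP[bm em] z0_lt_a ab oc ce.
  have ub x y : z0 < x -> x < y -> y < m -> (u x < u y) = (u y < u m).
    exact: chords_meet_preserving_betweenness.
  rewrite (ub a b)// (ub c e)//.
  have ob := lt_trans z0_lt_a ab; have oe := lt_trans oc ce.
  (* Both sides equal [u m < u n] for a further point [n] above [m]. *)
  have last2 x y : z0 < x -> x < y -> y < m -> (u x < u m) = (u y < u m).
    move=> ox xy ym; have [n mn] := T_unbounded m.
    by rewrite (chords_meet_preserving_betweenness ox (lt_trans xy ym) mn)
      (chords_meet_preserving_betweenness (lt_trans ox xy) ym mn).
  by case: (ltgtP b e) => [be|eb|->//]; [rewrite (last2 b e)|rewrite (last2 e b)].
have [a z0_lt_a] := T_unbounded z0; have [b ab] := T_unbounded a.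
have [uab|uab] := ltP (u a) (u b).
  left=> x y xy; have [xo|ox] := leP x z0; last by rewrite (key x y a b).
  have -> : x = z0 by apply/le_anti; rewrite xo z0_min.
  rewrite u_z0 lt_neqAle z0_min andbT -{1}u_z0 (inj_eq u_inj).
  by rewrite lt_eqF// (le_lt_trans _ xy).
right=> x y ox xy; rewrite lt_neqAle (inj_eq u_inj) gt_eqF//=.
by rewrite leNgt (key x y a b)// -leNgt.
Qed.

End CyclicOrder.

(** * Extension of increasing bijections from the rationals to the reals *)

Lemma rat_dense (R : realType) (x y : R) : x < y ->
  exists q : rat, x < ratr q < y.
Proof. by move=> /rat_in_itvoo[q]; rewrite in_itv; exists q. Qed.

(** Preimages of [F x - e] and [F x + e] bound a neighbourhood of [x] on which [F] varies by less
    than [e]. *)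
Lemma increasing_surjective_continuous (R : realType) (F : R -> R) :
  {homo F : x y / x < y} -> (forall y, exists x, F x = y) -> continuous F.
Proof.
move=> Fi Fs x; apply/cvgrPdist_lt => e e0.
have [a Fa] := Fs (F x - e); have [b Fb] := Fs (F x + e).
have Flt := leW_mono (le_mono Fi).
have xab : x \in `]a, b[ by rewrite in_itv /= -[a < x]Flt -[x < b]Flt Fa Fb; lra.
near=> t.
have : t \in `]a, b[ by near: t; exact: near_in_itvoo.
rewrite in_itv /= => /andP[/Fi + /Fi]; rewrite Fa Fb distrC ltr_norml; lra.
Unshelve. all: by end_near.
Qed.

(** The extension is [F x], the supremum of [v q] over the rationals [q <= x]. Since [v] hits every
    rational, [F] has no jumps. *)
Lemma rat_increasing_extension (R : realType) (v w : rat -> rat) :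
  {homo v : x y / x < y} -> cancel w v ->
  exists F : R -> R, [/\ {homo F : x y / x < y}, forall y, exists x, F x = y,
    continuous F & forall q, F (ratr q) = ratr (v q)].
Proof.
move=> vi wK.
pose S (x : R) : set R := [set ratr (v q) | q in [set q | (ratr q : R) <= x]].
pose F (x : R) : R := sup (S x).
have vle := ltW_homo vi.
have S0 x : S x !=set0.
  have [q /andP[_ qx]] := @rat_dense R (x - 1) x ltac:(lra).
  by exists (ratr (v q)), q => //=; exact: ltW.
have Sub x r : x < ratr r -> ubound (S x) (ratr (v r)).
  move=> xr _ [q /= qx <-]; rewrite ler_rat; apply: vle.
  by rewrite -(@ler_rat R); lra.
have Shub x : has_ubound (S x).
  have [r /andP[xr _]] := @rat_dense R x (x + 1) ltac:(lra).
  by exists (ratr (v r)); exact: Sub.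
have Fge x q : ratr q <= x -> ratr (v q) <= F x.
  by move=> qx; apply: ub_le_sup => //; exists q.
have Fle x q : x < ratr q -> F x <= ratr (v q).
  by move=> xq; apply: ge_sup; [exact: S0|exact: Sub].
have Fi : {homo F : x y / x < y}.
  (* Two rationals [a < b] are taken because [Fle] at [a] and [Fge] at [b] give only weak
     inequalities. *)
  move=> x y xy; have [a /andP[xa ay]] := rat_dense xy.
  have [b /andP[ab yb]] := rat_dense ay.
  apply: (le_lt_trans (Fle _ _ xa)); apply: (@lt_le_trans _ _ (ratr (v b))).
    by rewrite ltr_rat; apply: vi; rewrite -(@ltr_rat R).
  exact/Fge/ltW.
have Fr q : F (ratr q) = ratr (v q).
  apply/le_anti/andP; split; last exact: Fge.
  apply: ge_sup; [exact: S0|move=> _ [r /= rq <-]].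
  by rewrite ler_rat vle// -(@ler_rat R).
have Fs y : exists x, F x = y.
  pose U := [set x | F x <= y].
  have lo : exists q : rat, ratr (v q) < y.
    have [r /andP[_ ry]] := @rat_dense R (y - 1) y ltac:(lra).
    by exists (w r); rewrite wK.
  have hi : exists q : rat, y < ratr (v q).
    have [r /andP[ry _]] := @rat_dense R y (y + 1) ltac:(lra).
    by exists (w r); rewrite wK.
  have Fmono := leW_mono (le_mono Fi).
  have U0 : U !=set0 by have [q /ltW ?] := lo; exists (ratr q); rewrite /U /= Fr.
  have [q yq] := hi.
  have Uq r : y < ratr (v r) -> ubound U (ratr r).
    by move=> yr x /= Ux; apply/ltW; rewrite -Fmono Fr; exact: le_lt_trans Ux yr.
  have Uhub : has_ubound U by exists (ratr q); exact: Uq.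
  (* Were [F (sup U)] different from [y], some rational [r = v (w r)] would lie strictly between
     them, and [w r] would be on the wrong side of [sup U]. *)
  exists (sup U); apply/le_anti/andP; split; rewrite leNgt; apply/negP.
    move=> /rat_dense[r]; rewrite -{1 2}[r]wK => /andP[yr rF].
    have := ge_sup U0 (Uq _ yr); rewrite leNgt -Fmono Fr; lra.
  move=> /rat_dense[r]; rewrite -{1 2}[r]wK => /andP[Fr' ry].
  have := @ub_le_sup _ U Uhub (ratr (w r)); rewrite /U /= Fr => /(_ (ltW ry)).
  by rewrite leNgt -Fmono Fr Fr'.
exists F; split => //; exact: increasing_surjective_continuous.
Qed.

(** * Chords of the unit circle *)

Section PlaneChords.
Context {R : realType}.
Implicit Types x y z w p : R * R.

(** Twice the signed area of the triangle [xyz]; its sign tells on which side of the line [xy] the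
    point [z] lies. *)
Definition orient x y z :=
  (y.1 - x.1) * (z.2 - x.2) - (y.2 - x.2) * (z.1 - x.1).

Lemma segmentP x y p : segment x y p <->
  exists2 t : R, 0 <= t <= 1 & p = ((1 - t) * x.1 + t * y.1, (1 - t) * x.2 + t * y.2).
Proof.
rewrite /segment /line_path; split.
  by move=> [t /=]; rewrite in_itv /= => t01 <-; exists t.
by move=> [t t01 ->]; exists t; rewrite //= in_itv.
Qed.

Lemma segmentC x y : segment x y = segment y x.
Proof.
suff sub (a b : R * R) : segment a b `<=` segment b a by apply/seteqP; split; exact: sub.
move=> p /segmentP[t /andP[t0 t1] ->]; apply/segmentP; exists (1 - t).
  by apply/andP; split; lra.
by congr pair; ring.
Qed.

Lemma segment_l x y : segment x y x.
Proof.
apply/segmentP; exists 0; first by rewrite lexx ler01.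
by rewrite subr0 !mul1r !mul0r !addr0 -surjective_pairing.
Qed.

Lemma segment_r x y : segment x y y.
Proof. by rewrite segmentC; exact: segment_l. Qed.

(** At parameter [t] the squared norm is [1 - t * (1 - t)] times the squared distance of the ends,
    so it is 1 only at an end. *)
Lemma segment_circle x y p : unit_circle x -> unit_circle y -> segment x y p ->
  unit_circle p -> p = x \/ p = y.
Proof.
case: x => a b; case: y => c e; rewrite /unit_circle /= => ab ce.
move=> /segmentP[t _ -> /=] tP.
have [abce|abce] := eqVneq ((a - c) ^+ 2 + (b - e) ^+ 2) 0.
  have /eqP := abce; rewrite paddr_eq0 ?sqr_ge0// !sqrf_eq0 !subr_eq0.
  by move=> /andP[/eqP -> /eqP ->]; left; congr pair; ring.
have /eqP : (t * (1 - t)) * ((a - c) ^+ 2 + (b - e) ^+ 2) = 0 by nra.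
rewrite !mulf_eq0 (negbTE abce) orbF => /orP[/eqP ->|/eqP t1].
  by left; congr pair; ring.
have -> : t = 1 by lra.
by right; congr pair; ring.
Qed.

(** [orient x y] is affine in its third argument and vanishes on the line [xy]. At a common point it
    is a convex combination of two nonzero numbers of the same sign. *)
Lemma segments_disjoint x y z w : 0 < orient x y z * orient x y w ->
  ~ (segment x y `&` segment z w !=set0).
Proof.
case: x y z w => [a b] [c e] [f g] [h k]; rewrite /orient /= => same.
move=> [p [/segmentP[s _ ->] /segmentP[t /andP[t0 t1]] [/= E1 E2]]].
set A := (X in 0 < X * _) in same; set B := (X in 0 < _ * X) in same.
have : (1 - t) * A + t * B = 0.
  transitivity ((c - a) * (((1 - t) * g + t * k) - b) -
                (e - b) * (((1 - t) * f + t * h) - a)).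
    by rewrite /A /B; ring.
  by rewrite -E1 -E2; ring.
have A2 : 0 < A ^+ 2.
  rewrite lt_def sqr_ge0 sqrf_eq0 andbT.
  by apply: contraTneq same => ->; rewrite mul0r ltxx.
move=> /(congr1 (fun r => A * r)); rewrite mulr0 mulrDr !(mulrCA A) -expr2.
case: (ltP 0 t) => [t_gt0|t_le0]; last first.
  have -> : t = 0 by lra.
  by rewrite subr0 mul0r mul1r addr0; lra.
have := mulr_gt0 t_gt0 same.
have : 0 <= (1 - t) * A ^+ 2 by rewrite mulr_ge0 ?subr_ge0// ltW.
lra.
Qed.

(** The affine function [orient x y] vanishes at some point of [zw]. This point is on the line [xy]
    and in the unit disc, hence on the chord [xy]. *)
Lemma segments_cross x y z w :
  unit_circle x -> unit_circle y -> unit_circle z -> unit_circle w ->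
  orient x y z * orient x y w < 0 -> segment x y `&` segment z w !=set0.
Proof.
case: x y z w => [a b] [c e] [f g] [h k]; rewrite /unit_circle /orient /=.
move=> ab ce fg hk opp.
set A := (X in X * _ < 0) in opp; set B := (X in _ * X < 0) in opp.
have AB0 : A - B != 0.
  by rewrite subr_eq0; apply: contraTneq opp => ->; rewrite -leNgt -expr2 sqr_ge0.
(* The zero of [(1 - t) * A + t * B]. *)
pose t := A / (A - B).
have tAB : t * (A - B) = A by rewrite /t divfK.
have t01 : 0 <= t <= 1.
  have : 0 < (A - B) ^+ 2 by rewrite lt_def sqr_ge0 sqrf_eq0 AB0.
  by move=> AB2; apply/andP; split; nra.
pose p1 := (1 - t) * f + t * h; pose p2 := (1 - t) * g + t * k.
have pdet : (c - a) * (p2 - b) = (e - b) * (p1 - a).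
  apply/eqP; rewrite -subr_eq0; apply/eqP.
  transitivity ((1 - t) * A + t * B); first by rewrite /A /B /p1 /p2; ring.
  lra.
have pn : p1 ^+ 2 + p2 ^+ 2 <= 1.
  have -> : p1 ^+ 2 + p2 ^+ 2 = (1 - t) * (f ^+ 2 + g ^+ 2) + t * (h ^+ 2 + k ^+ 2)
      - t * (1 - t) * ((f - h) ^+ 2 + (g - k) ^+ 2) by rewrite /p1 /p2; ring.
  rewrite fg hk.
  have : 0 <= t * (1 - t) * ((f - h) ^+ 2 + (g - k) ^+ 2).
    case/andP: t01 => t0 t1; apply: mulr_ge0; first by rewrite mulr_ge0 ?subr_ge0.
    by apply: addr_ge0; exact: sqr_ge0.
  lra.
pose N := (c - a) ^+ 2 + (e - b) ^+ 2.
have N0 : N != 0.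
  rewrite /N paddr_eq0 ?sqr_ge0// !sqrf_eq0; apply/negP => /andP[/eqP ca /eqP eb].
  by move: opp; rewrite /A ca eb !mul0r subrr mul0r ltxx.
have Ngt0 : 0 < N by rewrite lt_def N0; apply: addr_ge0; exact: sqr_ge0.
(* The coordinate along [xy] of the orthogonal projection of [(p1, p2)]; by [pdet] the point is its
   own projection. *)
pose s := ((p1 - a) * (c - a) + (p2 - b) * (e - b)) / N.
have sN : s * N = (p1 - a) * (c - a) + (p2 - b) * (e - b) by rewrite /s divfK.
have s1 : p1 = (1 - s) * a + s * c.
  apply: (mulIf N0); transitivity (N * a + s * N * (c - a)); last by ring.
  rewrite sN; apply/eqP; rewrite -subr_eq0; apply/eqP.
  transitivity ((e - b) * ((e - b) * (p1 - a) - (c - a) * (p2 - b))).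
    by rewrite /N; ring.
  by rewrite pdet subrr mulr0.
have s2 : p2 = (1 - s) * b + s * e.
  apply: (mulIf N0); transitivity (N * b + s * N * (e - b)); last by ring.
  rewrite sN; apply/eqP; rewrite -subr_eq0; apply/eqP.
  transitivity ((c - a) * ((c - a) * (p2 - b) - (e - b) * (p1 - a))).
    by rewrite /N; ring.
  by rewrite pdet subrr mulr0.
exists (p1, p2); split; apply/segmentP; last by exists t.
exists s; last by rewrite /= -s1 -s2.
(* With [pn], this identity gives [s * (1 - s) >= 0], that is, [s] between 0 and 1. *)
have ps : p1 ^+ 2 + p2 ^+ 2 = 1 - s * (1 - s) * N.
  transitivity ((1 - s) * (a ^+ 2 + b ^+ 2) + s * (c ^+ 2 + e ^+ 2) - s * (1 - s) * N).
    by rewrite s1 s2 /N; ring.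
  by rewrite ab ce; ring.
have : 0 <= s * (1 - s).
  by rewrite -(pmulr_lge0 _ Ngt0); move: pn; rewrite ps; lra.
by move=> ss; apply/andP; split; nra.
Qed.

End PlaneChords.

(** * Angular parametrization of the circle and crossing in terms of parameters *)

Section CircleParam.
Context {R : realType}.
Implicit Types (q s t u v : R) (x y : S1 R).

Lemma circle_param_circle t : unit_circle (circle_param t).
Proof. exact: cos2Dsin2. Qed.

Definition cpt t : S1 R := SigSub (mem_set (circle_param_circle t)).

Lemma val_cpt t : set_val (cpt t) = circle_param t.
Proof. by []. Qed.

Lemma S1_circle x : unit_circle (set_val x).
Proof. exact: set_valP. Qed.

Lemma S1_inj x y : set_val x = set_val y -> x = y.
Proof. exact: val_inj. Qed.

Lemma cptD1 t : cpt (t + 1) = cpt t.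
Proof.
apply: S1_inj; rewrite !val_cpt /circle_param.
have -> : 2 * pi * (t + 1) = 2 * pi * t + pi *+ 2 by ring.
by rewrite cosD2pi sinD2pi.
Qed.

Lemma cptDz t (n : int) : cpt (t + n%:~R) = cpt t.
Proof.
have nat_case (m : nat) r : cpt (r + m%:R) = cpt r.
  by elim: m => [|m IH]; rewrite ?addr0// -natr1 addrA cptD1.
case: n => m; first by rewrite -pmulrn nat_case.
by rewrite NegzE mulrNz -pmulrn -(nat_case m.+1) subrK.
Qed.

Lemma sin_pi_gt0 t : -1 < t < 1 -> (0 < sin (pi * t)) = (0 < t).
Proof.
move=> /andP[t0 t1]; have p0 := pi_gt0 R.
case: (ltgtP t 0) => [tn|tp|->].
- apply/negbTE; rewrite -leNgt -[t]opprK mulrN sinN oppr_le0.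
  by apply: sin_ge0_pi; apply/andP; split; nra.
- by apply: sin_gt0_pi; apply/andP; split; nra.
- by rewrite mulr0 sin0 ltxx.
Qed.

Lemma sin_pi_lt0 t : -1 < t < 1 -> (sin (pi * t) < 0) = (t < 0).
Proof.
move=> /andP[t0 t1]; rewrite -oppr_gt0 -sinN -mulrN sin_pi_gt0 ?oppr_gt0//.
by apply/andP; split; lra.
Qed.

Lemma sin_pi_eq0 t : -1 < t < 1 -> (sin (pi * t) == 0) = (t == 0).
Proof.
by move=> t1; rewrite !eq_le !leNgt sin_pi_gt0// sin_pi_lt0.
Qed.

(** The identity [sin (2 a) + sin (2 b) - sin (2 (a + b)) = 4 sin a sin b sin (a + b)], with
    [a = pi * (t - s)] and [b = pi * (u - t)]. *)
Lemma orient_circle_param s t u :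
  orient (circle_param s) (circle_param t) (circle_param u) =
  4 * (sin (pi * (t - s)) * (sin (pi * (u - t)) * sin (pi * (u - s)))).
Proof.
transitivity (sin (2 * pi * t - 2 * pi * s) + sin (2 * pi * u - 2 * pi * t)
              - sin (2 * pi * u - 2 * pi * s)).
  by rewrite !sinB /orient /=; ring.
have dbl a : sin (2 * pi * a) = 2 * (sin (pi * a) * cos (pi * a)).
  by rewrite -mulrA mulr_natl sin_mulr2n mulr_natl [sin _ * _]mulrC.
rewrite -!mulrBr !dbl.
have -> : pi * (u - s) = pi * (t - s) + pi * (u - t) by ring.
rewrite sinD cosD.
have := cos2Dsin2 (pi * (t - s)); have := cos2Dsin2 (pi * (u - t)).
move: (sin _) (cos _) => a b; move: (sin _) (cos _) => c e ab ce.
have -> : 2 * (c * e) + 2 * (a * b) -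
    2 * ((c * b + e * a) * (e * b - c * a)) =
  2 * (c * e) * (1 - (b ^+ 2 + a ^+ 2)) + 2 * (a * b) * (1 - (e ^+ 2 + c ^+ 2))
  + 4 * (c * (a * (c * b + e * a))) by ring.
by rewrite ab ce !subrr !mulr0 !add0r.
Qed.

(** The angle difference has cosine 1, so the sine of its half [pi * (s - t)] vanishes. *)
Lemma cpt_inj s t : -1 < s - t < 1 -> cpt s = cpt t -> s = t.
Proof.
move=> st1 /(congr1 set_val); rewrite !val_cpt => -[cE sE].
apply/eqP; rewrite -subr_eq0 -sin_pi_eq0//; apply/eqP.
have : cos (2 * pi * s - 2 * pi * t) = 1.
  by rewrite cosB cE sE -!expr2 cos2Dsin2.
rewrite -mulrBr -mulrA mulr_natl cos_mulr2n cos2sin2 => E.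
by apply/eqP; rewrite -sqrf_eq0; apply/eqP; lra.
Qed.

Lemma cpt_surj q x : exists t, 0 <= t < 1 /\ x = cpt (q + t).
Proof.
suff: exists t, x = cpt t.
  move=> [t xt]; exists (t - q - (Num.floor (t - q))%:~R); split.
    have /andP[]  := real_floor_itv (num_real (t - q)).
    by rewrite intrD => ? ?; apply/andP; split; lra.
  by rewrite xt -[RHS](cptDz _ (Num.floor (t - q))); congr cpt; ring.
have p0 : 2 * pi != 0 :> R by rewrite mulf_neq0 ?gt_eqF ?pi_gt0.
have : unit_circle (set_val x) := S1_circle x.
case E : (set_val x) => [a b]; rewrite /unit_circle /= => ab.
have a1 : -1 <= a <= 1 by apply/andP; split; nra.
have ca : cos (acos a) = a by rewrite acosK// in_itv.
have sa : sin (acos a) = `|b| by rewrite sin_acos// -sqrtr_sqr; congr Num.sqrt; lra.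
(* [acos] reaches only the upper half circle; the lower one needs the opposite angle. *)
have [b0|b0] := leP 0 b.
  exists (acos a / (2 * pi)); apply: S1_inj.
  by rewrite E val_cpt /circle_param mulrC divfK// ca sa ger0_norm.
exists (- acos a / (2 * pi)); apply: S1_inj.
by rewrite E val_cpt /circle_param mulrC divfK// cosN sinN ca sa ltr0_norm// opprK.
Qed.

Lemma Q1P x : Q1 x <-> exists q : rat, x = cpt (ratr q).
Proof.
split=> [[q _ xq]|[q ->]]; first by exists q; exact: S1_inj.
exists (q - (Num.floor q)%:~R).
  have /andP[]  := real_floor_itv (num_real q).
  by rewrite intrD => ? ?; apply/andP; split; lra.
by rewrite -val_cpt rmorphB /= ratr_int -mulrNz cptDz.
Qed.

Lemma sin_between s t u : -1 < u - s < 1 -> -1 < u - t < 1 -> s != u -> t != u ->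
  (sin (pi * (u - t)) * sin (pi * (u - s)) < 0) = between s t u.
Proof.
move=> us ut su tu; rewrite mulr_lt0 !sin_pi_eq0// !subr_eq0 !sin_pi_lt0// !subr_lt0.
rewrite ![u == _]eq_sym su tu /= /between (lt_flip su) (lt_flip tu).
by case: (s < u); case: (t < u).
Qed.

Definition side q s t u :=
  orient (circle_param (q + s)) (circle_param (q + t)) (circle_param (q + u)).

(** Up to the positive factor [16 * sin (pi * (t - s)) ^+ 2], the product is [k u * k v], and [k] is
    negative exactly at points between [s] and [t]. *)
Lemma side_between q s t u v : -1 < t - s < 1 -> -1 < u - s < 1 -> -1 < u - t < 1 ->
  -1 < v - s < 1 -> -1 < v - t < 1 -> s != t -> s != u -> t != u -> s != v -> t != v ->
  if between s t u == between s t v then 0 < side q s t u * side q s t v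
  else side q s t u * side q s t v < 0.
Proof.
move=> ts us ut vs vt st su tu sv tv; set o := side q s t.
have oE w : o w = 4 * (sin (pi * (t - s)) * (sin (pi * (w - t)) * sin (pi * (w - s)))).
  rewrite /o /side orient_circle_param.
  by have E (a b : R) : q + a - (q + b) = a - b by [ring]; rewrite !E.
pose k w := sin (pi * (w - t)) * sin (pi * (w - s)).
have c0 : 0 < 16 * sin (pi * (t - s)) ^+ 2.
  by rewrite mulr_gt0// lt_def sqr_ge0 sqrf_eq0 sin_pi_eq0// subr_eq0 eq_sym st.
have -> : o u * o v = 16 * sin (pi * (t - s)) ^+ 2 * (k u * k v).
  by rewrite !oE /k; ring.
have k0 w : s != w -> t != w -> -1 < w - s < 1 -> -1 < w - t < 1 -> k w != 0.
  move=> sw tw ws wt; rewrite /k mulf_eq0 !sin_pi_eq0// !subr_eq0.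
  by rewrite ![w == _]eq_sym negb_or sw tw.
rewrite pmulr_rgt0// pmulr_rlt0// -!sin_between// -/(k u) -/(k v).
have := k0 u su tu us ut; have := k0 v sv tv vs vt.
case: (ltgtP (k u) 0) => // ku; case: (ltgtP (k v) 0) => //= kv _ _; nra.
Qed.

(** A shared end is itself a common point; otherwise the sign of the orientations decides. The
    circle is cut open at parameter [q]. *)
Lemma chord_cpt_meet q s t u v : 0 <= s < 1 -> 0 <= t < 1 -> 0 <= u < 1 ->
  0 <= v < 1 -> s != t ->
  chord (cpt (q + s)) (cpt (q + t)) `&` chord (cpt (q + u)) (cpt (q + v)) !=set0
  <-> chords_meet s t u v.
Proof.
move=> s01 t01 u01 v01 st.
have sub (a b : R) : 0 <= a < 1 -> 0 <= b < 1 -> -1 < a - b < 1.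
  by move=> /andP[? ?] /andP[? ?]; apply/andP; split; lra.
have ou := side_between q (sub _ _ t01 s01) (sub _ _ u01 s01) (sub _ _ u01 t01)
  (sub _ _ v01 s01) (sub _ _ v01 t01) st.
have [m|/chords_meetPn[su sv tu tv E]] := boolP (chords_meet s t u v); last first.
  split=> // /segments_disjoint[]; have := ou su tu sv tv.
  by rewrite /= E eqxx.
split=> // _; move: m; rewrite /chords_meet.
have [->|su] := eqVneq s u.
  by exists (circle_param (q + u)); split; exact: segment_l.
have [->|sv] := eqVneq s v.
  by exists (circle_param (q + v)); split; [exact: segment_l|exact: segment_r].
have [->|tu] := eqVneq t u.
  by exists (circle_param (q + u)); split; [exact: segment_r|exact: segment_l].
have [->|tv] := eqVneq t v.
  by exists (circle_param (q + v)); split; exact: segment_r.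
move=> /= /negbTE cross; have := ou su tu sv tv; rewrite /= cross.
by apply: segments_cross; exact: circle_param_circle.
Qed.

Lemma chordC x y : chord x y = chord y x.
Proof. exact: segmentC. Qed.

(** The ends of a chord are its only points on the circle. *)
Lemma chord_inj x y z w : x <> y -> z <> w -> chord x y = chord z w ->
  (x = z /\ y = w) \/ (x = w /\ y = z).
Proof.
move=> xy zw E.
have ends a : chord x y (set_val a) -> a = x \/ a = y.
  by move=> /segment_circle[| | |/S1_inj|/S1_inj]; try exact: S1_circle; [left|right].
have zE : z = x \/ z = y by apply: ends; rewrite E; exact: segment_l.
have wE : w = x \/ w = y by apply: ends; rewrite E; exact: segment_r.
move: zw; case: zE => ->; case: wE => ->.
- by [].
- by left.
- by right.
- by [].
Qed.

End CircleParam.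

(** * Compactness of the circle and continuity of maps on it *)

Section CircleTopology.
Context {R : realType}.
Implicit Types (q s t u v : R) (x y : S1 R).

Lemma set_val_continuous : continuous (set_val : S1 R -> R * R).
Proof. exact: initial_continuous. Qed.

Lemma cpt_continuous : continuous (@cpt R).
Proof.
have cp : continuous (@circle_param R).
  move=> t; have lin : {for t, continuous (fun t : R => 2 * pi * t)}.
    exact: mulrl_continuous.
  exact: (cvg_pair (continuous_comp lin (@continuous_cos _ _))
                   (continuous_comp lin (@continuous_sin _ _))).
move=> t U [? /= [[W oW <-]]] /= Wt sWU.
have Wn : nbhs (circle_param t) W by exact: open_nbhs_nbhs.
have sub : @circle_param R @^-1` W `<=` @cpt R @^-1` U by move=> s Ws; exact: sWU.
exact: (filterS sub (cp t W Wn)).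
Qed.

Lemma S1_hausdorff : hausdorff_space (S1 R).
Proof.
move=> x y xy; apply: S1_inj; apply: norm_hausdorff => A B Ax By.
have [z [Az Bz]] := xy _ _ (set_val_continuous Ax) (set_val_continuous By).
by exists (set_val z).
Qed.

Lemma cpt_closed_image (C : set R) : closed C -> closed (@cpt R @` (`[0, 1] `&` C)).
Proof.
move=> cC; apply: (compact_closed S1_hausdorff); apply: continuous_compact.
  exact: continuous_subspaceT cpt_continuous.
by apply: compact_closedI => //; exact: segment_compact.
Qed.

Lemma cpt_surj01 x : exists2 t, `[0, 1]%classic t & x = cpt t.
Proof.
have [t [/andP[t0 t1] ->]] := cpt_surj 0 x.
by exists t; rewrite ?add0r//= in_itv /= t0 ltW.
Qed.

Lemma S1_compact : compact [set: S1 R].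
Proof.
rewrite (_ : setT = @cpt R @` `[0, 1]).
  apply: continuous_compact; last exact: segment_compact.
  exact: continuous_subspaceT cpt_continuous.
apply/seteqP; split=> // x _; have [t t01 ->] := cpt_surj01 x.
by exists t.
Qed.

(* [cpt] restricted to [[0, 1]] is a quotient map, being a continuous
   surjection of a compact space onto a Hausdorff one. *)
Lemma circle_map_continuous (h : S1 R -> S1 R) (k : R -> S1 R) :
  continuous k -> (forall t, 0 <= t <= 1 -> h (cpt t) = k t) -> continuous h.
Proof.
move=> kc hk; apply/continuous_closedP => C cC.
rewrite (_ : _ @^-1` _ = @cpt R @` (`[0, 1] `&` (k @^-1` C))).
  by apply: cpt_closed_image; move/continuous_closedP: kc; exact.
apply/seteqP; split=> [x hx|_ [t [t01 kt] <-]] /=; last by rewrite hk.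
have [t t01 xt] := cpt_surj01 x; exists t => //; split=> //=.
by rewrite -hk// -xt.
Qed.

(** The preimage of a closed set under [g] is its image under [h], which is compact and hence
    closed. *)
Lemma continuous_inverse (h g : S1 R -> S1 R) :
  continuous h -> cancel h g -> cancel g h -> continuous g.
Proof.
move=> hc hK gK; apply/continuous_closedP => C cC.
rewrite (_ : _ @^-1` _ = h @` C).
  apply: (compact_closed S1_hausdorff); apply: continuous_compact.
    exact: continuous_subspaceT.
  exact: (subclosed_compact cC S1_compact).
by apply/seteqP; split=> [x gx|_ [x xA <-]] /=; [exists (g x)|rewrite hK].
Qed.

Lemma fst_continuous : continuous (fst : R * R -> R).
Proof. by move=> p; exact: cvg_fst. Qed.

Lemma snd_continuous : continuous (snd : R * R -> R).
Proof. by move=> p; exact: cvg_snd. Qed.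

Lemma orient_continuous x y :
  continuous (fun z : S1 R => orient (set_val x) (set_val y) (set_val z)).
Proof.
have c1 : continuous (fun z : S1 R => (set_val z).1).
  by move=> z; exact: (cvg_comp _ _ (@set_val_continuous z) (@fst_continuous _)).
have c2 : continuous (fun z : S1 R => (set_val z).2).
  by move=> z; exact: (cvg_comp _ _ (@set_val_continuous z) (@snd_continuous _)).
move=> z; rewrite /orient.
exact: (cvgB (cvgM (cvg_cst _) (cvgB (@c2 z) (cvg_cst _)))
             (cvgM (cvg_cst _) (cvgB (@c1 z) (cvg_cst _)))).
Qed.

Lemma rat_dense_eq (f g : R -> R) : continuous f -> continuous g ->
  (forall q : rat, f (ratr q) = g (ratr q)) -> f =1 g.
Proof.
move=> fc gc fg t; apply/eqP/negPn/negP => fgt.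
have fgc : continuous (fun t => f t - g t) by move=> s; exact: (cvgB (fc s) (gc s)).
have oU : open [set s | f s - g s != 0].
  have := open_comp (f := fun s => f s - g s) (D := [set r : R | r != 0]).
  by apply=> [s _|]; [exact: fgc|exact: open_neq].
have [s [fgq [q _ qE]]] : [set s | f s - g s != 0] `&` (@ratr R @` setT) !=set0.
  by apply: dense_rat => //; exists t; rewrite /= subr_eq0.
by move: fgq; rewrite /= -qE fg subrr eqxx.
Qed.

(** Each coordinate, pulled back along [cpt], is a continuous real function, determined by its
    values at the rationals. *)
Lemma S1_map_ext (f g : S1 R -> S1 R) : continuous f -> continuous g ->
  (forall x, Q1 x -> f x = g x) -> f =1 g.
Proof.
move=> fc gc fg x; have [t [_ ->]] := cpt_surj 0 x; rewrite add0r.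
have cc (h : S1 R -> S1 R) (p : R * R -> R) : continuous h -> continuous p ->
    continuous (fun t => p (set_val (h (cpt t)))).
  move=> hc pc s; exact: (cvg_comp _ _ (@cpt_continuous s)
    (cvg_comp _ _ (hc _) (cvg_comp _ _ (@set_val_continuous _) (pc _)))).
have fgq (q : rat) : f (cpt (ratr q)) = g (cpt (ratr q)) by apply/fg/Q1P; exists q.
apply: S1_inj.
have E (p : R * R -> R) : continuous p ->
    p (set_val (f (cpt t))) = p (set_val (g (cpt t))).
  move=> pc; have /(_ _ t) := rat_dense_eq (cc f p fc pc) (cc g p gc pc).
  by apply=> q; rewrite fgq.
have := E fst fst_continuous; have := E snd snd_continuous.
by move: (set_val _) (set_val _) => [a b] [c e] /= -> ->.
Qed.

End CircleTopology.

(** * Homeomorphisms preserve the intersection of chords *)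

Section HomeoChords.
Context {R : realType}.
Implicit Types (q s t u v : R) (x y z w : S1 R).

Lemma orient_neq0 x y z : x <> y -> x <> z -> y <> z ->
  orient (set_val x) (set_val y) (set_val z) != 0.
Proof.
have [s [/andP[s0 s1] ->]] := cpt_surj 0 x; have [t [/andP[t0 t1] ->]] := cpt_surj 0 y.
have [u [/andP[u0 u1] ->]] := cpt_surj 0 z; rewrite !add0r => st su tu.
have ne (a b : R) : cpt a <> cpt b -> b - a != 0.
  by move=> ab; rewrite subr_eq0; apply: contra_notN ab => /eqP ->.
rewrite !val_cpt orient_circle_param !mulf_neq0 ?sin_pi_eq0 ?ne//.
all: by apply/andP; split; lra.
Qed.

(* The third argument of [orient] runs along an arc of the circle on which
   the orientation cannot vanish, so its sign is constant. *)
Lemma disjoint_chords_image (h : S1 R -> S1 R) x y z w :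
  continuous h -> injective h -> x <> y ->
  ~ (chord x y `&` chord z w !=set0) ->
  ~ (chord (h x) (h y) `&` chord (h z) (h w) !=set0).
Proof.
move=> hc hI; have [q [_ ->]] := cpt_surj 0 x; rewrite add0r.
have [t [t01 ->]] := cpt_surj q y; have [u [u01 ->]] := cpt_surj q z.
have [v [v01 ->]] := cpt_surj q w.
(* The circle is cut open at [x], which gets parameter 0. *)
have -> : cpt q = cpt (q + 0) by rewrite addr0.
move=> qt; have t0 : 0 != t by apply/eqP => t0; apply: qt; rewrite -t0.
have z01 : 0 <= (0 : R) < 1 by rewrite lexx ltr01.
move=> disj; have {disj} /chords_meetPn[u0 v0 tu tv E] : ~~ chords_meet 0 t u v.
  by apply/negP => /(chord_cpt_meet q z01 t01 u01 v01 t0).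
apply: segments_disjoint.
pose psi r := orient (set_val (h (cpt (q + 0)))) (set_val (h (cpt (q + t))))
                     (set_val (h (cpt (q + r)))).
rewrite -/(psi u) -/(psi v).
have psic : continuous psi.
  move=> r; have qr : {for r, continuous (fun r => q + r)}.
    exact: cvgD (cvg_cst _) cvg_id.
  exact: (cvg_comp _ _ qr (cvg_comp _ _ (@cpt_continuous R _)
    (cvg_comp _ _ (hc _) (@orient_continuous R _ _ _)))).
wlog uv : u v u01 v01 u0 v0 tu tv E / u <= v => [hw|].
  by have [|/ltW vu] := leP u v; [exact: hw|rewrite mulrC; exact: hw].
rewrite ltNge; apply/negP => opp.
have [] := IVT (v := 0) uv (continuous_subspaceT psic).
  have [?|?] := leP (psi u) (psi v); apply/andP; split; nra.
move=> r; rewrite in_itv /= => /andP[ur rv]; apply/eqP.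
case/andP: u01 => u_ge0 u1; case/andP: v01 => v_ge0 v1; case/andP: t01 => t_ge0 t1.
have u_gt0 : 0 < u by rewrite lt_def eq_sym u0.
have rt : r != t.
  (* As [x] has parameter 0, hypothesis [E] puts [u] and [v] on the same side of [t], so the arc
     from [u] to [v] avoids [t]. *)
  apply/eqP => rt; move: E; rewrite /between u_gt0 (lt_le_trans u_gt0 uv).
  have -> : (t < u) = false by rewrite ltNge -rt ur.
  by have -> : (t < v) by rewrite lt_def eq_sym tv -rt.
have ne (a b : R) : -1 < a - b < 1 -> a != b -> h (cpt (q + a)) <> h (cpt (q + b)).
  move=> ab1 + /hI ab; apply/negP/negPn/eqP/(@addrI _ q)/(cpt_inj _ ab).
  by rewrite (_ : q + a - (q + b) = a - b)//; ring.
apply: orient_neq0; apply: ne => //; try by apply/andP; split; lra.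
- by rewrite lt_eqF// (lt_le_trans u_gt0).
- by rewrite eq_sym.
Qed.

(** The two directions are [disjoint_chords_image] for [h] and for its inverse. *)
Lemma chords_meet_homeo (h : homeo (S1 R)) x y z w : x <> y ->
  chord (h x) (h y) `&` chord (h z) (h w) !=set0 <->
  chord x y `&` chord z w !=set0.
Proof.
move=> xy; have /asboolP[hc hVc] := valP h.
have hK a : (val h)^-1%g (h a) = a by exact: symVK.
have hI : injective h := can_inj hK.
have hVI : injective (val h)^-1%g := can_inj (@symKV _ (val h)).
split=> m; apply: contrapT => nm; first exact: (disjoint_chords_image hc hI xy nm m).
apply: (disjoint_chords_image hVc hVI _ nm _); first by move=> /hI.
by rewrite !hK.
Qed.

End HomeoChords.

(** * The action of homeomorphisms on chords *)

Section Representation.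
Context {R : realType}.
Local Notation V := (vertex (rational_circle_graph R)).
Implicit Types (g : homeo_on (@Q1 R)) (c : V) (x y : S1 R).

Lemma homeo_on_inj g : injective g.
Proof. exact: can_inj (@symVK _ g). Qed.

Lemma homeo_on_Q1 g x : Q1 x -> Q1 (g x).
Proof.
have /asboolP gQ : preserves (@Q1 R) (val g) := valP g.
by move=> xQ; have : (g @` @Q1 R) (g x) by [exists x]; rewrite gQ.
Qed.

Lemma vertexP c : exists x y, [/\ Q1 x, Q1 y, x <> y & set_val c = chord x y].
Proof. exact: (set_valP c). Qed.

Lemma vertex_inj c c' : set_val c = set_val c' -> c = c'.
Proof. exact: val_inj. Qed.

Lemma chord_vertex x y : Q1 x -> Q1 y -> x <> y -> exists c, set_val c = chord x y.
Proof.
move=> xQ yQ xy; have C : rational_chords (chord x y) by exists x, y.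
by exists (SigSub (mem_set C)).
Qed.

(** Quantifying over all pairs of ends makes the image independent of the presentation of [c]. *)
Lemma chord_image_ex g c : exists c', forall x y, x <> y ->
  set_val c = chord x y -> set_val c' = chord (g x) (g y).
Proof.
have [x [y [xQ yQ xy cE]]] := vertexP c.
have gxy : g x <> g y by move=> /homeo_on_inj.
have [c' c'E] := chord_vertex (homeo_on_Q1 g xQ) (homeo_on_Q1 g yQ) gxy.
exists c' => z w zw; rewrite cE c'E => /(chord_inj xy zw)[[-> ->]//|[-> ->]].
exact: chordC.
Qed.

Definition chord_image g c : V := sval (cid (chord_image_ex g c)).

Lemma chord_imageE g c x y : x <> y -> set_val c = chord x y ->
  set_val (chord_image g c) = chord (g x) (g y).
Proof. exact: (svalP (cid (chord_image_ex g c))). Qed.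

Lemma chord_imageM g g' c :
  chord_image (g * g')%g c = chord_image g (chord_image g' c).
Proof.
have [x [y [_ _ xy cE]]] := vertexP c; apply: vertex_inj.
rewrite (chord_imageE _ xy cE) (chord_imageE _ _ (chord_imageE _ xy cE))//.
by move=> /homeo_on_inj.
Qed.

Lemma chord_image1 c : chord_image 1%g c = c.
Proof.
have [x [y [_ _ xy cE]]] := vertexP c; apply: vertex_inj.
by rewrite (chord_imageE _ xy cE) cE.
Qed.

Lemma chord_image_bij g : bijective (chord_image g).
Proof.
by exists (chord_image g^-1%g) => c; rewrite -chord_imageM ?mulVg ?mulgV chord_image1.
Qed.

Definition chord_sym g : sym V := Sym (asboolT (chord_image_bij g)).

Lemma chord_sym_aut g : is_graph_aut (chord_sym g).
Proof.
apply/asboolP => c c'; rewrite /= /chord_adj.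
have [x [y [_ _ xy cE]]] := vertexP c; have [z [w [_ _ zw c'E]]] := vertexP c'.
rewrite (chord_imageE _ xy cE) (chord_imageE _ zw c'E) cE c'E.
rewrite (chords_meet_homeo (val g) z w xy).
by split=> -[cc' m]; split=> // E; apply: cc'; 
  [rewrite E|exact: bij_inj (chord_image_bij g) _ _ E].
Qed.

Definition chord_aut g : graph_aut (rational_circle_graph R) :=
  GraphAut (chord_sym_aut g).

Lemma chord_autM : {morph chord_aut : g g' / (g * g')%g}.
Proof.
move=> g g'; do 2 apply: val_inj; apply/funext => c.
exact: chord_imageM.
Qed.

HB.instance Definition _ := isMultiplicative.Build _ _ chord_aut chord_autM.

End Representation.

(** * Rational points as a dense linear order with a minimum and no maximum *)

Record unit_rat := UnitRat { urat :> rat; _ : 0 <= urat < 1 }.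

HB.instance Definition _ := [isSub for urat].
HB.instance Definition _ := [Choice of unit_rat by <:].
HB.instance Definition _ := [SubChoice_isSubOrder of unit_rat by <: with ring_display].

Section RationalPoints.
Context {R : realType}.
Implicit Types (r s t u : unit_rat) (x y : S1 R) (q : rat).

Definition real_of r : R := ratr (urat r).

Lemma urat_itv r : 0 <= urat r < 1. Proof. exact: (valP r). Qed.

Lemma real_of_itv r : 0 <= real_of r < 1.
Proof.
have /andP[r0] := urat_itv r; rewrite -(@ltr_rat R) rmorph1 => r1.
by rewrite ler0q r0.
Qed.

Lemma lt_urat r s : (r < s)%O = (urat r < urat s).
Proof. by []. Qed.

Lemma real_of_lt r s : (real_of r < real_of s) = (r < s)%O.
Proof. by rewrite /real_of ltr_rat. Qed.

Lemma real_of_inj : injective real_of.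
Proof. by move=> r s /fmorph_inj/val_inj. Qed.

Lemma chords_meet_real r s t u :
  chords_meet (real_of r) (real_of s) (real_of t) (real_of u) = chords_meet r s t u.
Proof.
by rewrite /chords_meet /between !(inj_eq real_of_inj) !real_of_lt.
Qed.

Definition unit_rat0 : unit_rat := @UnitRat 0 isT.

Lemma unit_rat0_min r : (unit_rat0 <= r)%O.
Proof. by have /andP[] := urat_itv r. Qed.

Lemma unit_rat_dense r s : (r < s)%O -> exists2 t, (r < t)%O & (t < s)%O.
Proof.
rewrite lt_urat => rs; have /andP[r0 r1] := urat_itv r; have /andP[s0 s1] := urat_itv s.
have m01 : 0 <= (urat r + urat s) / 2 < 1 by apply/andP; split; lra.
by exists (UnitRat m01); rewrite lt_urat /=; lra.
Qed.

Lemma unit_rat_unbounded r : exists s, (r < s)%O.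
Proof.
have /andP[r0 r1] := urat_itv r.
have m01 : 0 <= (urat r + 1) / 2 < 1 by apply/andP; split; lra.
by exists (UnitRat m01); rewrite lt_urat /=; lra.
Qed.

(** Here [q] is the cut: the rational point of parameter [q] becomes the minimum of the order. *)
Definition point_at q r : S1 R := cpt (ratr q + real_of r).

Lemma point_at_inj q : injective (point_at q).
Proof.
move=> r s /cpt_inj E; apply/real_of_inj/(addrI (ratr q)); apply: E.
have /andP[? ?] := real_of_itv r; have /andP[? ?] := real_of_itv s.
by apply/andP; split; lra.
Qed.

Lemma point_at_Q1 q r : Q1 (point_at q r).
Proof. by apply/Q1P; exists (q + urat r); rewrite rmorphD. Qed.

Lemma Q1_point_at q x : Q1 x -> exists r, x = point_at q r.
Proof.
move=> /Q1P[p ->].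
have pq01 : 0 <= p - q - (Num.floor (p - q))%:~R < 1.
  have /andP[] := real_floor_itv (num_real (p - q)).
  by rewrite intrD => ? ?; apply/andP; split; lra.
exists (UnitRat pq01); rewrite /point_at /real_of /= -[RHS](cptDz _ (Num.floor (p - q))).
by congr cpt; rewrite !rmorphB /= ratr_int; ring.
Qed.

Lemma chord_point_meet q r s t u : r != s ->
  chord (point_at q r) (point_at q s) `&` chord (point_at q t) (point_at q u) !=set0
  <-> chords_meet r s t u.
Proof.
move=> rs; rewrite -chords_meet_real; apply: chord_cpt_meet; try exact: real_of_itv.
by rewrite (inj_eq real_of_inj).
Qed.

End RationalPoints.

(** * Injectivity of the action on chords *)

Section Faithful.
Context {R : realType}.

(** By density, agreement at rational points suffices; it is tested on two chords [rs] and [rt]. *)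
Lemma chord_aut_inj : injective (@chord_aut R).
Proof.
move=> g g' E.
have gE x y : Q1 x -> Q1 y -> x <> y -> chord (g x) (g y) = chord (g' x) (g' y).
  move=> xQ yQ xy; have [c cE] := chord_vertex xQ yQ xy.
  by rewrite -!(chord_imageE _ xy cE) -[chord_image g]/(chord_aut g : _ -> _) E.
do 3 apply: val_inj; apply/funext; apply: S1_map_ext.
- by have /asboolP[] := valP (val g).
- by have /asboolP[] := valP (val g').
move=> _ /(Q1_point_at 0)[r ->].
have [s] := another unit_rat_unbounded r r.
have [t tr ts] := another unit_rat_unbounded r s.
move=> sr _; pose p := @point_at R 0.
have ne a b : a != b -> p a <> p b by move=> ab /point_at_inj/eqP; apply/negP.
have Qp a : Q1 (p a) by exact: point_at_Q1.
have gI := @homeo_on_inj _ g; have g'I := @homeo_on_inj _ g'.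
have := gE (p r) (p s) (Qp _) (Qp _); have := gE (p r) (p t) (Qp _) (Qp _).
rewrite eq_sym in sr; rewrite eq_sym in tr.
move=> /(_ (ne _ _ tr)) E1 /(_ (ne _ _ sr)) E2.
have ng a b : a != b -> g (p a) <> g (p b) by move=> ab /gI; exact: ne.
have ng' a b : a != b -> g' (p a) <> g' (p b) by move=> ab /g'I; exact: ne.
(* If [g] and [g'] differ at [r], the ends are exchanged on both chords; then [g] takes the value of
   [g'] at [r] at both [s] and [t]. *)
have [[]//|[_ Es]] := chord_inj (ng _ _ sr) (ng' _ _ sr) E2.
have [[]//|[_ Et]] := chord_inj (ng _ _ tr) (ng' _ _ tr) E1.
by case: (ng _ _ ts); rewrite Es Et.
Qed.

End Faithful.

(** * Realization of graph automorphisms *)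

Section Surjective.
Context {R : realType}.
Local Notation V := (vertex (rational_circle_graph R)).
Local Notation p := (@point_at R 0).
Implicit Types (r s t u : unit_rat) (x y : S1 R) (q : rat) (c : V).

(** Adding equality to adjacency turns it into plain intersection, the relation [mt] of the
    reconstruction. *)
Definition touch c c' := c = c' \/ adj c c'.

Lemma touchE c c' : touch c c' <-> set_val c `&` set_val c' !=set0.
Proof.
split=> [[<-|[]//]|m]; last by have [->|cc'] := pselect (c = c'); [left|right].
have [x [y [_ _ _ ->]]] := vertexP c.
by exists (set_val x); split; exact: segment_l.
Qed.

(** Choice then gives a chord function on all pairs; on equal ends its value is arbitrary. *)
Lemma vertex_between_ex (a : unit_rat * unit_rat) :
  exists c, a.1 != a.2 -> set_val c = chord (p a.1) (p a.2).
Proof.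
have mk r s : r != s -> exists c, set_val c = chord (p r) (p s).
  move=> rs; apply: chord_vertex; try exact: point_at_Q1.
  by move=> /point_at_inj/eqP; apply/negP.
have [E|/mk[c cE]] := eqVneq a.1 a.2; last by exists c.
have [r z0r] := unit_rat_unbounded unit_rat0.
by have [c _] := mk unit_rat0 r (negbT (lt_eqF z0r)); exists c.
Qed.

Lemma point_map_of_graph_aut (phi : graph_aut (rational_circle_graph R)) :
  exists h h' : unit_rat -> unit_rat, [/\ cancel h h', cancel h' h,
    forall r s t u, r != s -> t != u ->
      chords_meet (h r) (h s) (h t) (h u) = chords_meet r s t u &
    forall r s c, r != s -> set_val c = chord (p r) (p s) ->
      set_val (phi c) = chord (p (h r)) (p (h s))].
Proof.
have /choice[ch chE0] := vertex_between_ex.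
have chE r s : r != s -> set_val (ch (r, s)) = chord (p r) (p s) by exact: (chE0 (r, s)).
have pne r s : r != s -> p r <> p s by move=> rs /point_at_inj/eqP; apply/negP.
have chV r s c : r != s -> set_val c = chord (p r) (p s) -> c = ch (r, s).
  by move=> rs cE; apply: vertex_inj; rewrite cE chE.
have /asboolP phi_adj : is_graph_aut (val phi) := valP phi.
have phi_touch c c' : touch (phi c) (phi c') <-> touch c c'.
  rewrite /touch phi_adj; split=> -[E|?]; try by right.
    by left; exact: can_inj (@symVK _ (val phi)) _ _ E.
  by left; rewrite E.
have [||r s|c|r s t u rs tu E|r s t u rs tu|h [h' [hK h'K hE]]] :=
  @chord_map_from_points _ unit_rat V (fun r s => ch (r, s)) touch
    _ _ _ _ _ _ phi (val phi)^-1%g (@symVK _ (val phi)) (@symKV _ (val phi)) phi_touch.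
- exact: unit_rat_unbounded.
- exact: unit_rat_dense.
- have [->//|rs] := eqVneq r s; apply: chV; first by rewrite eq_sym.
  by rewrite chE// chordC.
- have [x [y [xQ yQ xy cE]]] := vertexP c.
  have [r xr] := Q1_point_at 0 xQ; have [s ys] := Q1_point_at 0 yQ.
  have rs : r != s by apply/eqP => rs; apply: xy; rewrite xr ys rs.
  by exists r, s; split=> //; apply: chV; rewrite // cE xr ys.
- have : chord (p r) (p s) = chord (p t) (p u) by rewrite -!chE// E.
  by move=> /(chord_inj (pne _ _ rs) (pne _ _ tu))[] [/point_at_inj ? /point_at_inj ?];
    [left|right].
- by rewrite touchE !chE// chord_point_meet.
exists h, h'; split=> // [r s t u rs tu|r s c rs /(chV _ _ _ rs) ->].
  have hne a b : a != b -> h a != h b by rewrite (can_eq hK).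
  have m (a b a' b' : unit_rat) : a != b -> a' != b' ->
      chords_meet a b a' b' <-> touch (ch (a, b)) (ch (a', b')).
    by move=> ab ab'; rewrite touchE !chE// chord_point_meet.
  by apply/idP/idP; rewrite !m ?hne// -!hE// phi_touch.
by rewrite hE// chE// (can_eq hK).
Qed.

Lemma point_on_surj (b e : R) x : e = 1 \/ e = -1 ->
  exists2 t, 0 <= t < 1 & x = cpt (b + e * t).
Proof.
have [t [t01 ->]] := cpt_surj b x; case=> ->; first by exists t; rewrite ?mul1r.
(* Travelling backwards turns [t] into [1 - t], which leaves the range at [t = 0]. *)
have [->|t0] := eqVneq t 0; first by exists 0; rewrite ?mulr0// lexx ltr01.
exists (1 - t); first by case/andP: t01 => t_ge0 t1; apply/andP; split; lra.
by rewrite -[RHS]cptD1; congr cpt; ring.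
Qed.

(** Outside the unit interval the extension is the identity. It fixes 0 because an increasing
    surjection fixes the minimum. *)
Lemma unit_rat_extension (u v : unit_rat -> unit_rat) :
  {homo u : r s / (r < s)%O} -> cancel v u ->
  exists U U' : rat -> rat, [/\ {homo U : q q' / q < q'}, cancel U' U,
    forall r, U (urat r) = urat (u r), U 0 = 0 & U 1 = 1].
Proof.
move=> ui vK.
pose ext (f : unit_rat -> unit_rat) q :=
  if insub q is Some r then urat (f r) else q.
have ext_in f r : ext f (urat r) = urat (f r) by rewrite /ext valK.
have ext_out f q : ~~ (0 <= q < 1) -> ext f q = q by move=> q01; rewrite /ext insubN.
have sort q : (exists r, q = urat r) \/ ~~ (0 <= q < 1).
  have [q01|q01] := boolP (0 <= q < 1); last by right.
  by left; exists (UnitRat q01).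
exists (ext u), (ext v); split => //.
- move=> q q'; have [[r ->]|q01] := sort q; have [[s ->]|q01'] := sort q'.
  + by rewrite !ext_in; exact: ui.
  + rewrite ext_in ext_out//; have := urat_itv r; have := urat_itv (u r).
    move: q01'; rewrite negb_and -ltNge -leNgt; lra.
  + rewrite ext_in ext_out//; have := urat_itv s; have := urat_itv (u s).
    move: q01; rewrite negb_and -ltNge -leNgt; lra.
  + by rewrite !ext_out.
- by move=> q; have [[r ->]|q01] := sort q; [rewrite !ext_in vK|rewrite !ext_out].
- suff u0 : u unit_rat0 = unit_rat0 by rewrite -[0]/(urat unit_rat0) ext_in u0.
  apply/le_anti; rewrite unit_rat0_min andbT -[X in (_ <= X)%O]vK.
  by rewrite (ltW_homo ui)// unit_rat0_min.
- by rewrite ext_out.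
Qed.

(** The reflection [t |-> - t] modulo 1, which fixes 0. *)
Definition mirror_rat (r : unit_rat) : rat :=
  if urat r == 0 then 0 else 1 - urat r.

Lemma mirror_rat_itv r : 0 <= mirror_rat r < 1.
Proof.
rewrite /mirror_rat; case: eqVneq => // r0; have /andP[? ?] := urat_itv r.
by apply/andP; split; lra.
Qed.

Definition mirror r := UnitRat (mirror_rat_itv r).

Lemma mirrorK : involutive mirror.
Proof.
move=> r; apply: val_inj; rewrite /= /mirror_rat /= /mirror_rat.
have /andP[_ r1] := urat_itv r; case: (eqVneq (urat r) 0) => [->|r0].
  by rewrite eqxx.
by rewrite subr_eq0 gt_eqF// subKr.
Qed.

Lemma mirror_gt r s : (unit_rat0 < r)%O -> (r < s)%O -> (mirror s < mirror r)%O.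
Proof.
rewrite !lt_urat /= /mirror_rat => r0 rs.
by rewrite !gt_eqF ?(lt_trans r0 rs)//; lra.
Qed.

Lemma cpt_mirror (b : R) r : cpt (b - real_of (mirror r)) = cpt (b + real_of r).
Proof.
rewrite /real_of /= /mirror_rat; case: eqVneq => [->|_].
  by rewrite rmorph0 subr0 addr0.
by rewrite rmorphB rmorph1 -cptD1; congr cpt; ring.
Qed.

(* Seen from the image of [0], a map preserving the crossing of chords is
   increasing in one of the two directions of travel. *)
Lemma normalized_point_map (h h' : unit_rat -> unit_rat) :
  cancel h h' -> cancel h' h ->
  (forall r s t u, r != s -> t != u ->
    chords_meet (h r) (h s) (h t) (h u) = chords_meet r s t u) ->
  exists (e : R) (u v : unit_rat -> unit_rat), [/\ e = 1 \/ e = -1, cancel v u,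
    {homo u : r s / (r < s)%O} &
    forall r, p (h r) = cpt (real_of (h unit_rat0) + e * real_of (u r))].
Proof.
move=> hK h'K hmeet; pose b := urat (h unit_rat0).
(* The map [u] is [h] read in the order cut at the image of 0, so that it fixes the minimum. *)
have /choice[u uE] r : exists s, p (h r) = point_at b s.
  exact/Q1_point_at/point_at_Q1.
have /choice[v vE] s : exists r, point_at b s = p (h r).
  have [r ->] := Q1_point_at 0 (@point_at_Q1 R b s); exists (h' r).
  by rewrite h'K.
have uI : injective u.
  by move=> r s urs; apply: (can_inj hK); apply: (@point_at_inj R 0); rewrite !uE urs.
have vK : cancel v u by move=> s; apply: (@point_at_inj R b); rewrite -uE -vE.
have u0 : u unit_rat0 = unit_rat0.
  apply: (@point_at_inj R b); rewrite -uE /point_at /real_of /b.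
  by rewrite !rmorph0 add0r addr0.
have umeet r s t w : r != s -> t != w ->
    chords_meet (u r) (u s) (u t) (u w) = chords_meet r s t w.
  move=> rs tw; rewrite -[RHS]hmeet//.
  have hrs : h r != h s by rewrite (can_eq hK).
  have urs : u r != u s by rewrite (inj_eq uI).
  (* Crossing does not depend on the cut: both sides express that the same two chords of the circle
     meet. *)
  have E : chords_meet (u r) (u s) (u t) (u w) <-> chords_meet (h r) (h s) (h t) (h w).
    by rewrite -(@chord_point_meet R b _ _ _ _ urs) -!uE (chord_point_meet _ _ _ hrs).
  by apply/idP/idP => /E.
have [ui|ud] :=
  chords_meet_preserving_monotone unit_rat0_min unit_rat_unbounded uI u0 umeet.
  exists 1, u, v; split=> [|//|//|r]; first by left.
  by rewrite mul1r uE.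
exists (-1), (mirror \o u), (v \o mirror); split=> [|s|r s rs|r]; first by right.
- by rewrite /= vK mirrorK.
- have us0 : (unit_rat0 < u s)%O.
    rewrite lt_neqAle unit_rat0_min andbT -{1}u0 (inj_eq uI).
    by rewrite lt_eqF// (le_lt_trans (unit_rat0_min r)).
  (* The decreasing alternative says nothing about 0, which both [u] and [mirror] fix. *)
  have [->|r0] := eqVneq r unit_rat0.
    have r0 : mirror unit_rat0 = unit_rat0 by exact: val_inj.
    rewrite /= u0 r0 lt_neqAle unit_rat0_min andbT -r0 (inj_eq (inv_inj mirrorK)).
    by rewrite lt_eqF.
  apply: mirror_gt => //; apply: ud => //.
  by rewrite lt_neqAle unit_rat0_min eq_sym r0.
- by rewrite mulN1r cpt_mirror uE.
Qed.

(** The path [k] runs once around the circle from [cpt b] in the direction [e]; it closes up since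
    [F 0 = 0] and [F 1 = 1], and so induces a map [g] of the circle. *)
Lemma point_map_extension (h h' : unit_rat -> unit_rat) :
  cancel h h' -> cancel h' h ->
  (forall r s t u, r != s -> t != u ->
    chords_meet (h r) (h s) (h t) (h u) = chords_meet r s t u) ->
  exists g : homeo_on (@Q1 R), forall r, g (p r) = p (h r).
Proof.
move=> hK h'K hmeet.
have [e [u [v [e1 vK ui hE]]]] := normalized_point_map hK h'K hmeet.
have [U [U' [Ui U'K UE U0 U1]]] := unit_rat_extension ui vK.
have [F [Fi Fs Fc FE]] := rat_increasing_extension R Ui U'K.
have F0 : F 0 = 0 by rewrite -(rmorph0 (@ratr R)) FE U0.
have F1 : F 1 = 1 by rewrite -(rmorph1 (@ratr R)) FE U1.
have Flt := leW_mono (le_mono Fi); have Fle := le_mono Fi.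
set b := real_of (h unit_rat0) in hE.
pose k (t : R) : S1 R := cpt (b + e * F t).
have kc : continuous k.
  move=> t; have lin : continuous (fun t : R => b + e * F t).
    by move=> s; exact: (cvgD (cvg_cst _) (cvgM (cvg_cst _) (Fc s))).
  exact: (cvg_comp _ _ (lin t) (@cpt_continuous R _)).
have /choice[ang angE] x : exists t : R, 0 <= t < 1 /\ x = cpt t.
  by have [t [t01 ->]] := cpt_surj 0 x; exists t; rewrite add0r.
pose g x := k (ang x).
have gk (t : R) : 0 <= t <= 1 -> g (cpt t) = k t.
  (* The endpoint 1 is separate: [ang] is below 1, so [g (cpt 1)] is [k 0], which equals [k 1]. *)
  move=> /andP[t0]; rewrite le_eqVlt => /predU1P[->|t1].
    have [/andP[a0 a1] aE] := angE (cpt 1).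
    have -> : g (cpt 1) = k 0.
      congr k; apply: cpt_inj; first by apply/andP; split; lra.
      by rewrite -aE -[in RHS]cptD1 add0r.
    rewrite /k F0 F1 mulr0 addr0 mulr1; case: e1 => ->; first by rewrite cptD1.
    by rewrite -[RHS]cptD1 subrK.
  have [/andP[a0 a1] aE] := angE (cpt t).
  by congr k; apply: cpt_inj => //; apply/andP; split; lra.
have gI : injective g.
  move=> x y; have [/andP[x0 x1] xE] := angE x; have [/andP[y0 y1] yE] := angE y.
  rewrite /g /k => /cpt_inj E.
  (* Values of [F] in [[0, 1[] keep the two parameters less than one turn apart, as [cpt_inj]
     requires. *)
  have Fx : 0 <= F (ang x) < 1 by rewrite -{1}F0 -F1 Fle Flt x0.
  have Fy : 0 <= F (ang y) < 1 by rewrite -{1}F0 -F1 Fle Flt y0.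
  have /addrI : b + e * F (ang x) = b + e * F (ang y).
    apply: E; case/andP: Fx => ? ?; case/andP: Fy => ? ?.
    by apply/andP; case: e1 => ->; split; lra.
  move/mulfI => /(_ _)/(inc_inj Fle) E'; rewrite xE yE E'//.
  by case: e1 => ->; rewrite ?oppr_eq0 oner_neq0.
have gS y : exists x, g x = y.
  have [t /andP[t0 t1] ->] := point_on_surj b y e1; have [s sE] := Fs t.
  exists (cpt s); rewrite gk ?/k ?sE//.
  by rewrite -[0 <= s]Fle -[s <= 1]Fle sE F0 F1 t0 ltW.
have /choice[g' g'K] := gS.
have gK : cancel g g' by move=> x; apply: gI; rewrite g'K.
have gc := circle_map_continuous kc gk.
pose sg : sym (S1 R) := Sym (asboolT (Bijective gK g'K)).
have sgV : (sg^-1)%g =1 g' by move=> x; rewrite -{1}[x]g'K; exact: symVK.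
have sgh : is_homeo sg.
  apply/asboolP; split=> //; apply: (continuous_inverse gc); last exact: symKV sg.
  exact: symVK sg.
have gp r : g (p r) = p (h r).
  rewrite hE /point_at rmorph0 add0r gk.
    by rewrite /k /real_of FE UE.
  by have /andP[-> /ltW] := @real_of_itv R r.
have sgQ : preserves (@Q1 R) (Homeo sgh).
  apply/asboolP/seteqP; split=> [_ [x xQ <-]|x xQ].
    have [r ->] := Q1_point_at 0 xQ.
    by rewrite [X in Q1 X]gp; exact: point_at_Q1.
  have [r ->] := Q1_point_at 0 xQ; exists (p (h' r)); first exact: point_at_Q1.
  by rewrite [LHS]gp h'K.
by exists (HomeoOn sgQ).
Qed.

Lemma chord_aut_surj (phi : graph_aut (rational_circle_graph R)) :
  exists g, chord_aut g = phi.
Proof.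
have [h [h' [hK h'K hmeet phiE]]] := point_map_of_graph_aut phi.
have [g gE] := point_map_extension hK h'K hmeet.
exists g; do 2 apply: val_inj; apply/funext => c.
have [x [y [xQ yQ xy cE]]] := vertexP c.
have [r xr] := Q1_point_at 0 xQ; have [s ys] := Q1_point_at 0 yQ; subst x y.
have rs : r != s by apply/eqP => rs; apply: xy; rewrite rs.
apply: vertex_inj; rewrite [LHS](chord_imageE g xy cE) !gE.
by rewrite -(phiE _ _ _ rs cE).
Qed.

End Surjective.

Theorem corollary3p3 (R : realType) :
  exists f : {multiplicative homeo_on (@Q1 R) ->
                             graph_aut (rational_circle_graph R)},
    (forall (g : homeo_on (@Q1 R)) (x y : S1 R)
            (c : vertex (rational_circle_graph R)),
        Q1 x -> Q1 y -> x <> y -> set_val c = chord x y ->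
        set_val (f g c) = chord (g x) (g y))
    /\ bijective f.
Proof.
exists (@chord_aut R); split=> [g x y c _ _|]; first exact: chord_imageE.
have /choice[f' f'K] := @chord_aut_surj R.
by exists f' => // g; apply: chord_aut_inj; rewrite f'K.
Qed.
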